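(* For any integer $k\ge 3$ and constant $0<\eta\le 1$, there exists an $\alpha>0$ such that for all sufficiently large $n\in \mathbb{N}$, any $n$-vertex graph $G$ with $\delta(G)\ge \eta n$ and $\alpha(G)\le \alpha n$ contains an $\eta$-quasiperfect $T_k$-tiling for any $k$-vertex tree $T_k$.
   Context: Graphs are finite and simple; $\delta(G)$ is the minimum degree and $\alpha(G)$ is the independence number of $G$. An $F$-tiling in $G$ is a collection of vertex-disjoint copies of $F$ in $G$ (not necessarily induced). For $\eta\in(0,1]$ and a $k$-vertex graph $F$, an $F$-tiling in $G$ is $\eta$-quasiperfect if it covers all but at most $\lfloor 1/\eta\rfloor (k-1)$ vertices of $G$. *)

(* Defs.v *)
From HB Require Import structures.
From mathcomp Require Import all_boot all_order all_algebra.
From mathcomp Require Import reals.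

Set Implicit Arguments.
Unset Strict Implicit.
Unset Printing Implicit Defensive.

Import Order.TTheory GRing.Theory Num.Theory.

Structure sgraph := SGraph {
  vertex :> finType;
  adj : rel vertex;
  adj_sym : symmetric adj;
  adj_irr : irreflexive adj }.

Definition degree (G : sgraph) (v : G) : nat := #|[set w : G | adj v w]|.

(* Every degree is at most #|G|, so for nonempty G the neutral element #|G|
   does not affect the minimum. *)
Definition min_degree (G : sgraph) : nat :=
  \big[minn/#|G|]_(v : G) degree v.

Definition independent (G : sgraph) (S : {set G}) : bool :=
  [forall x in S, forall y in S, ~~ adj x y].

Definition independence_number (G : sgraph) : nat :=
  \max_(S : {set G} | independent S) #|S|.

Definition connected (G : sgraph) : Prop :=
  0 < #|G| /\ forall x y : G, connect (@adj G) x y.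

(* A single vertex is no ucycle (no loops), but [:: x; y] is one for every edge
   xy; graph cycles are exactly the ucycles of size at least 3. *)
Definition acyclic (G : sgraph) : Prop :=
  forall c : seq G, ucycle (@adj G) c -> size c < 3.

Definition is_tree (G : sgraph) : Prop := connected G /\ acyclic G.

(* A copy of F in G is given by an embedding of F as a (not necessarily
   induced) subgraph. *)
Definition is_copy (F G : sgraph) (f : {ffun F -> G}) : Prop :=
  injective f /\ forall x y : F, adj x y -> adj (f x) (f y).

Definition copy_vertices (F G : sgraph) (f : {ffun F -> G}) : {set G} :=
  [set f x | x : F].

Definition is_tiling (F G : sgraph) (t : {set {ffun F -> G}}) : Prop :=
  (forall f, f \in t -> is_copy f) /\
  (forall f g, f \in t -> g \in t -> f != g ->
     [disjoint copy_vertices f & copy_vertices g]).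

Definition covered (F G : sgraph) (t : {set {ffun F -> G}}) : {set G} :=
  \bigcup_(f in t) copy_vertices f.

Definition quasiperfect (R : realType) (eta : R) (F G : sgraph)
    (t : {set {ffun F -> G}}) : Prop :=
  (#|~: covered t|%:Z <= Num.floor (1 / eta) * (#|F|%:Z - 1))%R.

(* Main.v *)
Require Import Defs.
From HB Require Import structures.
From mathcomp Require Import all_boot all_order all_algebra.
From mathcomp Require Import reals ring lra zify.

Set Implicit Arguments.
Unset Strict Implicit.
Unset Printing Implicit Defensive.

Import Order.TTheory GRing.Theory Num.Theory.

(** Let m be the integer part of 1/eta, so that (m + 1) eta > 1, let x be a leaf
    of T and y its neighbour. Any set of more than (k - 1) alpha(G) vertices
    contains a copy of T, so the greedy algorithm tiles all but o(n) vertices;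
    the leftover is reduced by exchanges. Before running it, fix disjoint tiles
    f_z (z in Y) in which z plays the role of y, where Y is a small linear set
    such that almost every vertex u has nearly the proportion eta of Y among its
    neighbours. If u is uncovered and z in Y is adjacent to u, then u can take
    the place of the leaf x in f_z: the hole, a "token", moves from u to f_z(x).

    Suppose more than m (k - 1) vertices are uncovered, and consider groups of
    tokens, initially singletons, such that the tokens of a group can all be sent
    to arbitrary places of a common linear subset of Y. As long as there are m + 1
    groups with sets I_0, ..., I_m, double counting (with (m + 1) eta > 1) yields
    two of them and linearly many z in Y each reachable by one swap from linearly
    many places of both sets; these two groups merge. With m groups left, some
    group has k tokens; they are sent to a copy of T, which becomes a new tile.
    Each such step spoils boundedly many of the tiles f_z, and if alpha is small
    there are few steps. *)

(** * Copies of a tree in a set of vertices *)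

(** Read from the right, such a list builds a tree by attaching leaves one at a time; an induction
    on it strips a leaf off the head. *)
Inductive tree_order (T : sgraph) : seq T -> Prop :=
| tree_order1 r : tree_order [:: r]
| tree_order_cons s v y : tree_order s -> v \notin s -> y \in s -> adj v y ->
    (forall z, z \in s -> adj v z -> z = y) -> tree_order (v :: s).

Definition adj_in (T : sgraph) (s : seq T) : rel T :=
  [rel a b | [&& adj a b, a \in s & b \in s]].

Lemma adj_in_sym (T : sgraph) (s : seq T) : connect_sym (adj_in s).
Proof.
apply: sym_connect_sym => a b; rewrite /adj_in /= adj_sym.
by case: (a \in s); case: (b \in s); rewrite ?andbF.
Qed.

Lemma tree_order_uniq (T : sgraph) (s : seq T) : tree_order s -> uniq s.
Proof. by elim=> //= {}s v y _ -> ->. Qed.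

Lemma tree_order_connect (T : sgraph) (s : seq T) :
  tree_order s -> {in s &, forall a b, connect (adj_in s) a b}.
Proof.
elim=> [r a b|{}s v y os IH vs ys vy _ a b].
  by rewrite !inE => /eqP-> /eqP->.
have sub c d : c \in s -> d \in s -> connect (adj_in (v :: s)) c d.
  move=> cs ds; have /connectP [p pp ->] := IH _ _ cs ds.
  apply/connectP; exists p => //; apply: sub_path pp => e f /and3P[ef es fs].
  by rewrite /adj_in /= ef !inE es fs !orbT.
have vy' : connect (adj_in (v :: s)) v y.
  by apply: connect1; rewrite /adj_in /= vy !inE eqxx ys orbT.
rewrite !inE => /orP[/eqP->|as_] /orP[/eqP->|bs] //.
- by apply: connect_trans vy' (sub _ _ _ _).
- by rewrite adj_in_sym; apply: connect_trans vy' (sub _ _ _ _).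
exact: sub.
Qed.

(** Otherwise a path inside [s] between two neighbours of [v] would close up through [v] to a cycle
    of length at least 3. *)
Lemma acyclic_unique_neighbor (T : sgraph) (s : seq T) (v : T) :
  acyclic T -> {in s &, forall a b, connect (adj_in s) a b} -> v \notin s ->
  {in s &, forall a b, adj v a -> adj v b -> a = b}.
Proof.
move=> acT con vs a b as_ bs va vb; apply/eqP/negPn/negP => ab.
have /connectP [p0 pp0 lb0] := con _ _ as_ bs.
case/shortenP: pp0 lb0 => p pp up _ lb.
have ps : {subset p <= s}.
  elim: p a {ab va as_ lb up} pp => //= c p IH a /andP[/and3P[_ _ cs] pp] d.
  by rewrite inE => /orP[/eqP->//|]; apply: IH pp _.
have : size (v :: a :: p) < 3.
  apply: acT; apply/andP; split.
    rewrite /= rcons_path va /= -lb adj_sym vb andbT.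
    by apply: sub_path pp => c d /and3P[].
  rewrite cons_uniq up andbT inE negb_or.
  apply/andP; split; first by apply: contraNneq vs => ->.
  by apply: contra vs; apply: ps.
case: p lb {pp up ps} => [/= ba|//]; by rewrite ba eqxx in ab.
Qed.

Lemma tree_order_exists (T : sgraph) (j : nat) :
  is_tree T -> j < #|T| -> exists2 s : seq T, tree_order s & size s = j.+1.
Proof.
move=> [[T0 con] acT]; elim: j => [_|j IH jT].
  by have /card_gt0P [r _] := T0; exists [:: r] => //; constructor.
have [s os ss] := IH (ltnW jT).
case: (pickP [pred vy : T * T | [&& vy.1 \notin s, vy.2 \in s & adj vy.1 vy.2]]).
  move=> [v y] /= /and3P[vs ys vy]; exists (v :: s); last by rewrite /= ss.
  apply: (tree_order_cons os vs ys vy) => z zs vz.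
  exact: (acyclic_unique_neighbor acT (tree_order_connect os) vs zs ys vz vy).
move=> no.
(* A list that cannot be extended is closed under adjacency, hence is all of [T] by
   connectedness. *)
have cl : closed (@adj T) (mem s).
  move=> a b ab; apply/idP/idP => h; apply/negPn/negP => h'.
    by have := no (b, a); rewrite /= h' h adj_sym ab.
  by have := no (a, b); rewrite /= h' h ab.
have [r rs] : exists r, r \in s by case: (s) ss => // r ? _; exists r; rewrite inE eqxx.
have : #|T| <= size s.
  rewrite -(card_uniqP (tree_order_uniq os)); apply: subset_leq_card.
  by apply/subsetP => v _; rewrite -(closed_connect cl (con r v)).
by rewrite ss leqNgt jT.
Qed.

Lemma tree_order_full (T : sgraph) : is_tree T ->
  exists2 s : seq T, tree_order s & (size s = #|T| /\ forall v, v \in s).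
Proof.
move=> tT; have [[T0 _] _] := tT.
have [|s os ss] := @tree_order_exists T #|T|.-1 tT; first by rewrite prednK.
rewrite prednK // in ss; exists s => //; split=> // v.
have /subset_leqif_cards [_ /esym] : [set z in s] \subset [set: T] by exact: subsetT.
rewrite cardsT cardsE (card_uniqP (tree_order_uniq os)) ss eqxx => /eqP/setP/(_ v).
by rewrite !inE.
Qed.

Lemma tree_leaf (T : sgraph) : is_tree T -> 1 < #|T| ->
  exists x y : T, adj x y /\ forall z, adj x z -> z = y.
Proof.
move=> tT T1; have [s os [ss full]] := tree_order_full tT.
case: os ss full => [r /= E|{}s v y _ _ ys vy uy _ full]; first by rewrite -E in T1.
exists v, y; split=> // z vz; apply: (uy) => //.
by have := full z; rewrite inE => /orP[/eqP zv|//]; rewrite zv adj_irr in vz.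
Qed.

Section Host.
Variable G : sgraph.
Notation al := (independence_number G).

Definition nbh (v : G) : {set G} := [set w | adj v w].

Lemma maximal_independent (W : {set G}) : exists2 S : {set G},
  S \subset W & #|S| <= al /\ forall v, v \in W :\: S -> exists2 u, u \in S & adj v u.
Proof.
pose p (S : {set G}) := independent S && (S \subset W).
have p0 : p set0.
  by rewrite /p sub0set andbT; apply/forall_inP => x; rewrite inE.
case: (@arg_maxnP _ set0 p (fun S => #|S|) p0) => S /andP[iS SW] mx.
exists S => //; split; first exact: (@leq_bigmax_cond _ _ (fun S : {set G} => #|S|)).
move=> v /setDP[vW vS].
case: (pickP [pred u | (u \in S) && adj v u]) => [u /andP[]|no]; first by exists u.
have : p (v |: S).
  rewrite /p subUset sub1set vW SW !andbT.
  apply/forall_inP => x /setU1P xv; apply/forall_inP => y /setU1P yv.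
  case: xv yv => [->|xS] [->|yS]; first by rewrite adj_irr.
  - by have := no y; rewrite /= yS => /= ->.
  - by have := no x; rewrite /= xS adj_sym => /= ->.
  by have /forall_inP/(_ _ xS)/forall_inP/(_ _ yS) := iS.
by move/mx; rewrite cardsU1 vS; lia.
Qed.

Section Tree.
Variable T : sgraph.
Hypothesis tT : is_tree T.

(* Gyarfas' trick: embed the tree minus a leaf outside a maximal independent
   set, which then supplies the image of the leaf. *)
Lemma tree_order_embed (s : seq T) (W : {set G}) :
  tree_order s -> (size s).-1 * al < #|W| ->
  exists g : T -> G, [/\ {in s &, injective g}, {in s, forall v, g v \in W} &
    {in s &, forall u v, adj u v -> adj (g u) (g v)}].
Proof.
move=> os; elim: os W => [r W /=|{}s v y os IH vs ys vy uy W /= hW].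
  move=> /card_gt0P [w wW]; exists (fun=> w).
  split; first by move=> a b; rewrite !inE => /eqP-> /eqP->.
    by [].
  by move=> a b; rewrite !inE => /eqP-> /eqP->; rewrite adj_irr.
have [S SW [Sal Sdom]] := maximal_independent W.
have [|g [ginj gW ghom]] := IH (W :\: S).
  have s0 : 0 < size s by case: (s) ys.
  by rewrite cardsDS //; move: hW; rewrite -{1}(prednK s0) mulSn; lia.
have [w wS gw] := Sdom _ (gW _ ys).
exists (fun u => if u == v then w else g u).
have nv u : u \in s -> (u == v) = false by move=> us; apply: contraNF vs => /eqP <-.
have wg u : u \in s -> w <> g u.
  by move=> us E; have := gW _ us; rewrite -E inE wS.
split.
- move=> a b; rewrite !inE => /orP[/eqP->|as_] /orP[/eqP->|bs] //; rewrite ?eqxx ?nv //.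
  + by move/wg => /(_ bs).
  + by move/esym/wg => /(_ as_).
  + exact: ginj.
- move=> a; rewrite inE => /orP[/eqP->|as_]; first by rewrite eqxx (subsetP SW).
  by rewrite nv //; have /setDP[] := gW _ as_.
- move=> a b; rewrite !inE => /orP[/eqP->|as_] /orP[/eqP->|bs]; rewrite ?eqxx ?nv //.
  + by rewrite adj_irr.
  + by move=> vb; rewrite (uy _ bs vb) adj_sym.
  + by rewrite adj_sym => va; rewrite (uy _ as_ va).
  + exact: ghom.
Qed.

Lemma tree_copy (W : {set G}) : #|T|.-1 * al < #|W| ->
  exists2 f : {ffun T -> G}, is_copy f & copy_vertices f \subset W.
Proof.
have [s os [ss full]] := tree_order_full tT; rewrite -ss => hW.
have [g [gi gW gh]] := tree_order_embed os hW.
exists (finfun g); last first.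
  by apply/subsetP => _ /imsetP[v _ ->]; rewrite ffunE gW.
split=> [a b|a b ab]; rewrite !ffunE; first exact: gi.
exact: gh.
Qed.

(** A copy of [T] inside the neighbourhood of [r] stays a copy when its image of [y] is replaced by
    [r], since [r] is adjacent to all the other vertices used. *)
Lemma rooted_tree_copy (r : G) (y : T) (W : {set G}) :
  W \subset nbh r -> #|T|.-1 * al < #|W| ->
  exists f : {ffun T -> G}, [/\ is_copy f, f y = r & forall v, v != y -> f v \in W].
Proof.
move=> Wr /tree_copy [g [gi gh] gW].
have gW' v : g v \in W by apply: (subsetP gW); apply: imset_f.
have rg v : adj r (g v) by have := subsetP Wr _ (gW' v); rewrite inE.
have rng v : r <> g v by move=> E; have := rg v; rewrite -E adj_irr.
exists [ffun v => if v == y then r else g v]; split; last 1 first.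
- by move=> v /negPf vy; rewrite ffunE vy.
- split=> a b; rewrite !ffunE; case: (eqVneq a y) => [->|_]; case: (eqVneq b y) => [->|_] //.
  + by move/rng.
  + by move/esym/rng.
  + exact: gi.
  + by rewrite adj_irr.
  + by move=> _; rewrite adj_sym.
  + exact: gh.
- by rewrite ffunE eqxx.
Qed.

End Tree.
End Host.

(** * Tilings and leaf exchanges *)

Section Tilings.
Variables (G T : sgraph).
Implicit Types (t : {set {ffun T -> G}}) (g : {ffun T -> G}).

Lemma mem_copy g v : g v \in copy_vertices g.
Proof. exact: imset_f. Qed.

Lemma card_copy_vertices g : is_copy g -> #|copy_vertices g| = #|T|.
Proof. by move=> [gi _]; rewrite card_imset. Qed.

Lemma covered_mem t g : g \in t -> copy_vertices g \subset covered t.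
Proof. by move=> gt; apply: bigcup_sup. Qed.

Lemma covered_add t g : covered (g |: t) = copy_vertices g :|: covered t.
Proof.
apply/setP => v; rewrite in_setU; apply/bigcupP/orP => [[h /setU1P[->|ht] vh]|].
- by left.
- by right; apply/bigcupP; exists h.
case=> [vg|/bigcupP[h ht vh]]; first by exists g; rewrite ?setU11.
by exists h; rewrite // setU1r.
Qed.

Lemma is_tiling_add t g : is_tiling t -> is_copy g ->
  [disjoint copy_vertices g & covered t] -> is_tiling (g |: t).
Proof.
move=> [tc td] gc dg; split=> [h /setU1P[->//|]|h h']; first exact: tc.
have dgh e : e \in t -> [disjoint copy_vertices g & copy_vertices e].
  by move=> et; apply: disjointWr dg; apply: covered_mem.
move=> /setU1P[->|ht] /setU1P[->|ht'] ne; rewrite ?eqxx // in ne *.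
- exact: dgh.
- by rewrite disjoint_sym; apply: dgh.
- exact: td.
Qed.

Lemma is_tiling_sub t t' : t' \subset t -> is_tiling t -> is_tiling t'.
Proof.
move=> /subsetP st [tc td]; split=> [h ht|h h' ht ht']; first by apply: tc; apply: st.
by apply: td; apply: st.
Qed.

Lemma covered_remove t g : is_tiling t -> g \in t ->
  covered (t :\ g) = covered t :\: copy_vertices g.
Proof.
move=> tt gt; have [_ td] := tt; rewrite -{2}(setD1K gt) covered_add setDUl setDv set0U.
apply/esym/setDidPl; rewrite disjoint_sym; apply/bigcup_disjointP => h /setD1P[hg ht].
by apply: td; rewrite // eq_sym.
Qed.

(* [L] indexes the prepared tiles that no exchange has altered yet. *)
Definition state (f : G -> {ffun T -> G}) (U L : {set G}) : Prop :=
  exists t, [/\ is_tiling t, covered t = ~: U & forall y, y \in L -> f y \in t].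

Lemma state_add f (U L : {set G}) g : state f U L -> is_copy g ->
  copy_vertices g \subset U -> state f (U :\: copy_vertices g) L.
Proof.
move=> [t [tt ct tL]] gc gU; exists (g |: t); split.
- by apply: is_tiling_add => //; rewrite ct disjoints_subset setCK.
- by rewrite covered_add ct setCD setUC.
- by move=> y /tL ht; rewrite setU1r.
Qed.

Variables (x0 y0 : T) (f : G -> {ffun T -> G}) (Y : {set G}).
Hypothesis leaf : forall z, adj x0 z -> z = y0.
Hypothesis (fy0 : forall y, y \in Y -> f y y0 = y).

Lemma state_uncovered (U L : {set G}) y v : state f U L -> y \in L -> f y v \notin U.
Proof.
move=> [t [tt ct tL]] /tL fyt; rewrite -in_setC -ct.
by apply: (subsetP (covered_mem fyt)); apply: mem_copy.
Qed.

(* The uncovered [v] replaces the leaf [f y x0] of the tile [f y]. *)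
Lemma state_swap (U L : {set G}) y v : L \subset Y -> state f U L ->
  v \in U -> y \in L -> adj v y -> state f (f y x0 |: U :\ v) (L :\ y).
Proof.
move=> LY st vU yL vy; have [t [tt ct tL]] := st; have fyt := tL _ yL.
have nU w : f y w \notin U := state_uncovered w st yL.
have nv w : f y w <> v by move=> E; have := nU w; rewrite E vU.
pose g := [ffun w => if w == x0 then v else f y w].
have [fyi fyh] := tt.1 _ fyt.
have gc : is_copy g.
  split=> a b; rewrite !ffunE; case: (eqVneq a x0) => [->|_]; case: (eqVneq b x0) => [->|_] //.
  - by move/esym/nv.
  - by move/nv.
  - exact: fyi.
  - by rewrite adj_irr.
  - by move/leaf=> ->; rewrite fy0 // (subsetP LY).
  - by rewrite adj_sym => /leaf ->; rewrite fy0 ?(subsetP LY) // adj_sym.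
  - exact: fyh.
have Eg : copy_vertices g = v |: copy_vertices (f y) :\ f y x0.
  apply/setP => w; rewrite !inE; apply/imsetP/orP => [[a _ ->]|].
    rewrite ffunE; case: (eqVneq a x0) => [_|ax]; [by left|right].
    by rewrite mem_copy andbT; apply: contraNneq ax => /fyi ->.
  case=> [/eqP->|/andP[ne /imsetP[a _ E]]]; first by exists x0; rewrite // ffunE eqxx.
  exists a; rewrite // ffunE ifN //; apply: contraNneq ne => ax; by rewrite E ax.
have cr := covered_remove tt fyt.
exists (g |: t :\ f y); split.
- apply: is_tiling_add => //; first by apply: is_tiling_sub tt; rewrite subD1set.
  rewrite cr Eg -setI_eq0 ct; apply/eqP/setP => w; rewrite !inE.
  case: (eqVneq w v) => [->|_]; rewrite ?vU ?andbF //=.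
  by case: (w \in copy_vertices _); rewrite ?andbF.
- rewrite covered_add cr Eg ct; apply/setP => w; rewrite !inE.
  case: (eqVneq w v) => [->|_] /=; first by case: (eqVneq v (f y x0)) => // /esym/nv.
  case: (eqVneq w (f y x0)) => [->|_] /=; first by rewrite mem_copy.
  case: (boolP (w \in copy_vertices (f y))) => //= /imsetP[a _ ->]; by rewrite nU.
- move=> z /setD1P[zy zL]; rewrite !inE tL // andbT; apply/orP; right.
  by apply: contraNneq zy => E; rewrite -(fy0 (subsetP LY _ zL)) E fy0 // (subsetP LY).
Qed.

End Tilings.

(** * Moving tokens *)

Section Moves.
Variables (G T : sgraph) (x0 y0 : T) (f : G -> {ffun T -> G}) (Y : {set G}).
Hypothesis leaf : forall z, adj x0 z -> z = y0.
Hypothesis fy0 : forall y, y \in Y -> f y y0 = y.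
Variables (L0 : {set G}) (f0 : nat).

(** The tile [f z] takes [y0] to [z], so different elements of [L] have different tiles, which are
    disjoint. *)
Lemma state_inj (U L : {set G}) : L \subset Y -> state f U L ->
  {in L &, injective (fun z => f z x0)}.
Proof.
move=> LY [t [[_ td] _ tL]] z z' zL zL' E; apply/eqP/negPn/negP => nz.
have nf : f z != f z'.
  by apply: contraNneq nz => Ef; rewrite -(fy0 (subsetP LY _ zL)) Ef fy0 // (subsetP LY).
have /pred0P/(_ (f z x0)) := td _ _ (tL _ zL) (tL _ zL') nf.
by rewrite /= mem_copy E mem_copy.
Qed.

(* Uncovering [f z x0] instead of [u] by at most [l + 1] swaps, which spare the
   tiles of any prescribed small set [F]. *)
Definition movable (l : nat) (u z : G) : Prop :=
  forall U L F : {set G}, L \subset L0 -> state f U L -> u \in U -> z \in L ->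
    z \notin F -> #|L0 :\: L| + #|F| + l <= f0 ->
  exists L' : {set G}, [/\ L' \subset L, state f (f z x0 |: U :\ u) L',
    L :&: F \subset L' & #|L :\: L'| <= l.+1].

Lemma movable_leq l l' u z : l <= l' -> movable l u z -> movable l' u z.
Proof.
move=> ll mv U L F LL st uU zL zF h.
have [|L' [? ? ? le]] := mv U L F LL st uU zL zF; first by lia.
by exists L'; split=> //; lia.
Qed.

Hypothesis L0Y : L0 \subset Y.

Lemma movable_adj u z : adj u z -> movable 0 u z.
Proof.
move=> uz U L F LL st uU zL zF _; exists (L :\ z); split.
- by rewrite subD1set.
- exact: (state_swap leaf fy0 (subset_trans LL L0Y)).
- apply/subsetP => w; rewrite !inE => /andP[-> wF]; rewrite andbT.
  by apply: contraNneq zF => <-.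
- rewrite setDDr setDv set0U; apply: leq_trans (_ : #|[set z]| <= _); last by rewrite cards1.
  by rewrite subset_leq_card // subsetIr.
Qed.

(** The token travels first to [f y x0] for some [y] in [I], then by one more swap to [f z x0].
    Among more than [f0] candidates, some [y] has an unaltered tile, differs from [z] and lies
    outside [F]; during the first journey [z] is protected together with [F]. *)
Lemma movable_step l u z (I : {set G}) : I \subset L0 ->
  (forall y, y \in I -> movable l u y) ->
  f0 < #|[set y in I | adj (f y x0) z]| -> movable l.+1 u z.
Proof.
move=> IL mv hI U L F LL st uU zL zF hF.
have [y yA yB] : exists2 y, y \in [set y in I | adj (f y x0) z] &
    y \notin (L0 :\: L) :|: (z |: F).
  apply/subsetPn; apply/negP => /subset_leq_card.
  by rewrite cardsU cardsU1; lia.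
move: yA yB; rewrite !inE !negb_or => /andP[yI yz] /and3P[yL yneqz yF].
rewrite (subsetP IL) // andbT negbK in yL.
have [||L1 [L1L st1 FL1 cL1]] := mv y yI U L (z |: F) LL st uU yL.
- by rewrite !inE negb_or yneqz.
- rewrite cardsU1; have := leq_b1 (z \notin F).
  by move: (z \notin F : nat) hF; clear=> e; lia.
have zL1 : z \in L1 by apply: (subsetP FL1); rewrite !inE zL eqxx.
have fyU : f y x0 \notin U :\ u.
  by rewrite !inE negb_and (state_uncovered x0 st yL) orbT.
have := state_swap leaf fy0 (subset_trans L1L (subset_trans LL L0Y)) st1 (setU11 _ _) zL1 yz.
rewrite setU1K // => st2; exists (L1 :\ z); split=> //.
- by apply: subset_trans L1L; rewrite subD1set.
- apply/subsetP => w; rewrite !inE => /andP[wL wF].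
  rewrite (subsetP FL1) ?inE ?wL ?wF ?orbT // andbT.
  by apply: contraNneq zF => <-.
- have : L :\: (L1 :\ z) \subset z |: (L :\: L1).
    by apply/subsetP => w; rewrite !inE; case: eqVneq => //=.
  move/subset_leq_card; rewrite cardsU1 => h; apply: leq_trans h _.
  exact: leq_add (leq_b1 _) cL1.
Qed.

(** The tokens move one by one while the targets of the waiting tokens are protected. The allowance
    [l.+2] per pair covers both the at most [l.+1] spoiled tiles and the protected set. *)
Lemma movable_seq l (ps : seq (G * G)) (U L : {set G}) :
  L \subset L0 -> state f U L -> uniq (unzip1 ps) -> uniq (unzip2 ps) ->
  {subset unzip1 ps <= U} -> {subset unzip2 ps <= L} ->
  (forall p, p \in ps -> movable l p.1 p.2) ->
  #|L0 :\: L| + size ps * l.+2 + l <= f0 ->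
  exists U' L' : {set G}, [/\ L' \subset L, state f U' L', #|U'| <= #|U|,
    {subset U' <= U :|: [set f z x0 | z in L]} & [/\
    forall p, p \in ps -> f p.2 x0 \in U',
    forall u, u \in U -> u \notin unzip1 ps -> u \in U' &
    #|L :\: L'| <= size ps * l.+1]].
Proof.
elim: ps U L => [|[u z] ps IH] U L LL st /=.
  by exists U, L; split=> //; [move=> v vU; rewrite inE vU | rewrite setDv cards0].
move=> /andP[u1 un1] /andP[z1 un2] s1 s2 mv hF.
have uU : u \in U by apply: s1; rewrite inE eqxx.
have zL : z \in L by apply: s2; rewrite inE eqxx.
have cps : #|[set w in unzip2 ps]| <= size ps by rewrite cardsE (leq_trans (card_size _)) ?size_map.
have [||L1 [L1L st1 FL1 cL1]] := mv (u, z) (mem_head _ _) U L [set w in unzip2 ps] LL st uU zL.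
- by rewrite inE.
- by move: cps hF; clear; lia.
have fzU : f z x0 \notin U := state_uncovered x0 st zL.
have cD : #|L0 :\: L1| <= #|L0 :\: L| + #|L :\: L1|.
  apply: leq_trans (leq_card_setU _ _); apply: subset_leq_card; apply/subsetP => w.
  by rewrite !inE; case: (w \in L); rewrite //= ?andbT ?andbF ?orbF // => /andP[].
have [||||||U2 [L2 [L2L st2 cU2 sU2 [tU2 rU2 cL2]]]] := IH _ _ (subset_trans L1L LL) st1 => //.
- move=> w wp; rewrite !inE s1 ?inE ?wp ?orbT // andbT; apply/orP; right.
  by apply: contraNneq u1 => /= <-.
- move=> w wp; apply: (subsetP FL1); by rewrite !inE wp s2 // inE wp orbT.
- by move=> p pp; apply: mv; rewrite inE pp orbT.
- by move: hF cD cL1; clear; rewrite mulSn; lia.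
exists U2, L2; split.
- exact: subset_trans L1L.
- exact: st2.
- apply: leq_trans cU2 _; rewrite cardsU1 (cardsD1 u U) uU; by case: (_ \notin _).
- move=> w /sU2; rewrite !inE => /orP[/orP[/eqP->|/andP[_ ->]//]|/imsetP[y yL1 ->]].
    by apply/orP; right; apply/imsetP; exists z.
  by apply/orP; right; apply/imsetP; exists y; rewrite // (subsetP L1L).
split.
- move=> p; rewrite inE => /orP[/eqP->/=|]; last exact: tU2.
  (* A token that has arrived is not moved again: its place [f z x0] was covered at the start, so it
     is no source of a later pair. *)
  apply: rU2; first by rewrite setU11.
  by apply: contraNN fzU => fz; apply: s1; rewrite inE fz orbT.
- move=> w wU; rewrite inE negb_or => /andP[wu wps].
  by apply: rU2; rewrite // !inE wu wU orbT.
- suff : #|L :\: L2| <= #|L :\: L1| + #|L1 :\: L2|.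
    by move=> h; apply: leq_trans h _; rewrite mulSn; apply: leq_add.
  apply: leq_trans (leq_card_setU _ _); apply: subset_leq_card; apply/subsetP => w.
  by rewrite !inE; case: (w \in L1); rewrite //= ?andbT ?andbF ?orbF // => /andP[].
Qed.

End Moves.

(** * Merging groups of tokens *)

Lemma card_sum_mem (V : finType) (A : {set V}) (p : pred V) :
  #|[set v in A | p v]| = \sum_(v in A) (p v : nat).
Proof.
rewrite -sum1_card (eq_bigl (fun v => (v \in A) && p v)) => [|v]; last by rewrite inE.
by rewrite big_mkcondr; apply: eq_bigr => v _; case: (p v).
Qed.

Lemma subset_of_card (V : finType) (A : {set V}) (t : nat) :
  t <= #|A| -> exists2 B : {set V}, B \subset A & #|B| = t.
Proof.
move=> tA; exists [set v in take t (enum A)].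
  by apply/subsetP => v; rewrite inE => /mem_take; rewrite mem_enum.
rewrite cardsE (card_uniqP _) ?take_uniq ?enum_uniq // size_take -cardE.
by case: ltnP => //; move: tA; lia.
Qed.

Lemma leq_card_bigcup (V : finType) (A : {pred V}) (F : V -> {set V}) :
  #|\bigcup_(i in A) F i| <= \sum_(i in A) #|F i|.
Proof.
elim/big_ind2: _ => [|B m C n hB hC|//]; first by rewrite cards0.
exact: leq_trans (leq_card_setU _ _) (leq_add hB hC).
Qed.

Section Merge.
Variables (V : finType) (D : rel V) (r P t : nat) (L R : {set V}) (J : V -> {set V}).
Hypotheses (cR : #|R| = r) (P0 : 0 < P) (L0 : 0 < #|L|) (t0 : 0 < t).
Hypothesis JL : forall g, g \in R -> J g \subset L.
Hypothesis cJ : forall g, g \in R -> #|J g| = t.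
Hypothesis dense : forall y, y \in L ->
  P.+1 * #|L| <= r * P * #|[set z in L | D y z]|.

Let e g z := #|[set y in J g | D y z]|.
(** The threshold is t/(2rP), so that [r] light sets contribute at most t/(2P) in total, half of the
    surplus t/P over [t] that the density provides on average. *)
Let heavy g z := t <= 2 * r * P * e g z.
Let shared := [set z in L | [exists g in R, exists h in R, [&& g != h, heavy g z & heavy h z]]].

Let e_le g z : g \in R -> e g z <= t.
Proof.
by move=> gR; rewrite -(cJ gR) subset_leq_card //; apply/subsetP => y; rewrite inE => /andP[].
Qed.

Let sum_e : r * t * (P.+1 * #|L|) <= r * P * (\sum_(z in L) \sum_(g in R) e g z).
Proof.
rewrite exchange_big /= big_distrr /= -{1}cR -mulnA -sum_nat_const.
apply: leq_sum => g gR.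
under eq_bigr do rewrite /e card_sum_mem.
rewrite exchange_big /= big_distrr /= -{1}(cJ gR) -sum_nat_const.
apply: leq_sum => y yJ; rewrite -card_sum_mem; apply: dense.
exact: (subsetP (JL gR)).
Qed.

(** At most one index is heavy at [z], and it contributes at most [t]; all the others are light. *)
Let sum_unshared z : z \in L -> z \notin shared ->
  2 * r * P * (\sum_(g in R) e g z) <= 2 * r * P * t + r * t.
Proof.
move=> zL; rewrite inE zL /= => nsh.
case: (pickP [pred g in R | heavy g z]) => [g0 /andP[g0R hg0]|light].
  rewrite (bigD1 g0) //= mulnDr; apply: leq_add; first by rewrite leq_mul2l e_le ?orbT.
  rewrite big_distrr /= -[X in _ <= X * _]cR -sum_nat_const [leqRHS](bigD1 g0) //=.
  apply: leq_trans (leq_addl _ _); apply: leq_sum => g /andP[gR gg0].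
  rewrite leqNgt; apply: contra nsh => hg.
  apply/exists_inP; exists g => //; apply/exists_inP; exists g0 => //.
  by rewrite gg0 hg0 andbT /heavy; apply: ltnW.
apply: leq_trans (leq_addl _ _); rewrite big_distrr /= -[X in _ <= X * _]cR -sum_nat_const.
apply: leq_sum => g gR; have /= := light g.
by rewrite gR /= /heavy => /negbT; rewrite -ltnNge => /ltnW.
Qed.

(** By [sum_e] the inner sum averages at least t + t/P. It is at most t + t/(2P) at unshared places
    and at most rt at shared ones, so the latter must be numerous. *)
Let many_shared : #|L| <= 2 * r * P * #|shared|.
Proof.
have r0 : 0 < r.
  have /card_gt0P [y yL] := L0.
  by have := dense yL; case: (r) => //; rewrite !mul0n; lia.
have up : 2 * r * P * (\sum_(z in L) \sum_(g in R) e g z) <=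
    #|L| * (2 * r * P * t + r * t) + #|shared| * (2 * r * P * (r * t)).
  have shL : shared \subset L by apply/subsetP => z; rewrite inE => /andP[].
  rewrite (big_setID shared) /= (setIidPr shL) mulnDr addnC; apply: leq_add.
    apply: (@leq_trans (#|L :\: shared| * (2 * r * P * t + r * t))).
      rewrite big_distrr /= -sum_nat_const; apply: leq_sum => z /setDP[zL zs].
      exact: sum_unshared.
    by rewrite leq_mul2r subset_leq_card ?orbT // subsetDl.
  rewrite big_distrr /= -sum_nat_const; apply: leq_sum => z _.
  rewrite leq_mul2l -[X in _ <= X * _]cR -sum_nat_const; apply/orP; right.
  by apply: leq_sum => g; apply: e_le.
have lo := sum_e; move: lo up; set S := \sum_(z in L) _ => lo up.
have : r * t * #|L| <= r * t * (2 * r * P * #|shared|).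
  move: lo up; move: #|L| #|shared| => l s lo up; nia.
by rewrite leq_pmul2l // muln_gt0 r0.
Qed.

(** The shared places are distributed over at most r^2 sets [K g h], so one of these is large. The
    constant is twice (2rP)r^2; the factor 2 yields the contradiction if all of them are small. *)
Lemma merge_equal_size : exists g h, [/\ g \in R, h \in R, g != h &
  exists K : {set V}, [/\ K \subset L, #|L| <= 4 * P * r ^ 3 * #|K| &
    forall z, z \in K -> t <= 2 * r * P * #|[set y in J g | D y z]| /\
                         t <= 2 * r * P * #|[set y in J h | D y z]|]].
Proof.
pose K g h := [set z in L | heavy g z && heavy h z].
have shK : shared \subset \bigcup_(g in R) \bigcup_(h in R | h != g) K g h.
  apply/subsetP => z; rewrite inE => /andP[zL /exists_inP[g gR /exists_inP[h hR /and3P[gh hg hh]]]].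
  apply/bigcupP; exists g => //; apply/bigcupP; exists h; first by rewrite hR eq_sym.
  by rewrite inE zL hg hh.
case: (pickP [pred gh : V * V | [&& gh.1 \in R, gh.2 \in R, gh.1 != gh.2 &
    #|L| <= 4 * P * r ^ 3 * #|K gh.1 gh.2|]]) => [[g h] /= /and4P[gR hR gh cK]|no].
  exists g, h; split=> //; exists (K g h); split=> //.
    by apply/subsetP => z; rewrite inE => /andP[].
  by move=> z; rewrite inE => /and3P[].
have small g h : g \in R -> h \in R -> h != g -> 4 * P * r ^ 3 * #|K g h| <= #|L|.
  move=> gR hR hg; apply: ltnW; rewrite ltnNge; apply/negbT.
  by have := no (g, h); rewrite /= gR hR eq_sym hg.
have : 4 * P * r ^ 3 * #|shared| <= r * (r * #|L|).
  apply: leq_trans (leq_mul (leqnn _) (subset_leq_card shK)) _.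
  apply: leq_trans (leq_mul (leqnn _) (leq_card_bigcup _ _)) _.
  rewrite big_distrr /= -[X in _ <= X * _]cR -sum_nat_const; apply: leq_sum => g gR.
  apply: leq_trans (leq_mul (leqnn _) (leq_card_bigcup _ _)) _.
  rewrite big_distrr /= -[X in _ <= X * _]cR -sum_nat_const.
  rewrite [leqRHS](bigID (fun h => h != g)) /=; apply: leq_trans (leq_addr _ _).
  by apply: leq_sum => h /andP[hR hg]; apply: small.
have r0 : 0 < r.
  have /card_gt0P [y yL] := L0.
  by have := dense yL; case: (r) => //; rewrite !mul0n; lia.
have := many_shared; rewrite !expnS expn0; nia.
Qed.

End Merge.

Lemma merge_sets (V : finType) (D : rel V) (r P c : nat) (L R : {set V}) (I : V -> {set V}) :
  #|R| = r -> 0 < P -> 0 < #|L| ->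
  (forall g, g \in R -> I g \subset L /\ #|L| <= c * #|I g|) ->
  (forall y, y \in L -> P.+1 * #|L| <= r * P * #|[set z in L | D y z]|) ->
  exists g h, [/\ g \in R, h \in R, g != h &
  exists K : {set V}, [/\ K \subset L, #|L| <= 4 * P * r ^ 3 * c.+1 * #|K| &
    forall z, z \in K -> #|L| <= 4 * P * r ^ 3 * c.+1 * #|[set y in I g | D y z]| /\
                         #|L| <= 4 * P * r ^ 3 * c.+1 * #|[set y in I h | D y z]|]].
Proof.
move=> cR P0 L0 hI dense.
(* The averaging needs sets of one size. Passing from [c] to [c.+1] leaves room for rounding up: [t]
   exceeds |L|/(c+1) but no [#|I g|]. *)
pose t := (#|L| %/ c.+1).+1.
have tc : #|L| < c.+1 * t by rewrite mulnC ltn_ceil.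
have tI g : g \in R -> t <= #|I g|.
  move=> gR; have [IL cI] := hI g gR; rewrite ltn_divLR //.
  by have := L0; nia.
pose J g := odflt set0 [pick B : {set V} | (B \subset I g) && (#|B| == t)].
have JP g : g \in R -> J g \subset I g /\ #|J g| = t.
  move=> gR; rewrite /J; case: pickP => [B /andP[-> /eqP]//|no].
  by have [B BI cB] := subset_of_card (tI g gR); have := no B; rewrite BI cB eqxx.
have [||g [h [gR hR gh [K [KL cK hK]]]]] :=
    @merge_equal_size V D r P t L R J cR P0 L0 isT _ _ dense.
- by move=> g gR; apply: subset_trans (proj1 (JP g gR)) (proj1 (hI g gR)).
- by move=> g /JP[].
have r0 : 0 < r by rewrite -cR; apply/card_gt0P; exists g.
have r3 : r <= r ^ 3 by rewrite -{1}(expn1 r) leq_pexp2l.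
have mono g0 z : g0 \in R -> t <= 2 * r * P * #|[set y in J g0 | D y z]| ->
    #|L| <= 4 * P * r ^ 3 * c.+1 * #|[set y in I g0 | D y z]|.
  move=> gR0 h1; have JI : #|[set y in J g0 | D y z]| <= #|[set y in I g0 | D y z]|.
    apply: subset_leq_card; apply/subsetP => y; rewrite !inE => /andP[yJ ->].
    by rewrite (subsetP (proj1 (JP g0 gR0))).
  apply: leq_trans (ltnW tc) _; apply: leq_trans (leq_mul (leqnn _) h1) _.
  rewrite mulnA mulnC [leqRHS]mulnC; apply: leq_mul => //.
  rewrite mulnC leq_mul2r; apply/orP; right; move: r3; nia.
exists g, h; split=> //; exists K; split=> //.
  apply: leq_trans cK _; rewrite leq_mul2r leq_pmulr ?orbT //.
by move=> z /hK [h1 h2]; split; apply: mono.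
Qed.

Lemma fiber_pigeonhole (V : finType) (W R : {set V}) (h : V -> V) (k : nat) :
  (forall w, w \in W -> h w \in R) -> #|R| * k < #|W| ->
  exists2 a, a \in R & k < #|[set w in W | h w == a]|.
Proof.
move=> hW hk; case: (pickP [pred a in R | k < #|[set w in W | h w == a]|]) => [a /andP[]|no].
  by exists a.
move: hk; rewrite ltnNge => /negP[].
rewrite -[#|W|]sum1_card (partition_big h [in R]) //= -sum_nat_const.
apply: leq_sum => a aR; have := no a; rewrite /= aR /= => /negbT; rewrite -leqNgt.
by apply: leq_trans; rewrite -sum1_card (eq_bigl _ _ (fun w => in_set _ w)).
Qed.

(** The targets of a single token are its neighbours, of proportion at least 1/(rP); each merge
    turns a loss [c] into the 4Pr^3(c+1) of [merge_sets]. *)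
Fixpoint merge_const (r P j : nat) : nat :=
  if j is j'.+1 then 4 * P * r ^ 3 * (merge_const r P j').+1 else r * P.

Lemma merge_const_leq r P i j : 0 < r -> 0 < P -> i <= j -> merge_const r P i <= merge_const r P j.
Proof.
move=> r0 P0; elim: j => [|j IH]; first by case: i.
rewrite leq_eqVlt => /orP[/eqP->//|/IH le]; apply: leq_trans le _ => /=.
have : 0 < r ^ 3 by rewrite expn_gt0 r0.
by move: (r ^ 3) (merge_const r P j) => x y; nia.
Qed.

Lemma merge_const_gt0 r P j : 0 < r -> 0 < P -> 0 < merge_const r P j.
Proof.
by move=> r0 P0; case: j => [|j] /=; rewrite !muln_gt0 ?expn_gt0 ?r0 ?P0.
Qed.

(** * Augmenting the tiling *)

Section Augment.
Variables (G T : sgraph) (x0 y0 : T) (f : G -> {ffun T -> G}) (Y : {set G}) (m P : nat).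
Hypothesis leaf : forall z, adj x0 z -> z = y0.
Hypothesis fy0 : forall y, y \in Y -> f y y0 = y.
Hypotheses (P0 : 0 < P) (tT : is_tree T) (T1 : 1 < #|T|).
Notation al := (independence_number G).
Let C := merge_const m.+1 P.

(** The groups are the fibres of [grp], named by elements of [R], and [I a] is the common target set
    of group [a]. Each of the [j] merges removes one group and adds one swap to the moves; m + j <=
    |W| ensures that m + 1 groups are present before each merge. *)
Lemma group_tokens (L W : {set G}) (f0 j : nat) : L \subset Y ->
  (forall u, u \in W :|: [set f y x0 | y in L] ->
     P.+1 * #|L| <= m.+1 * P * #|[set z in L | adj u z]|) ->
  C j * f0 < #|L| -> m + j <= #|W| ->
  exists (R : {set G}) (grp : G -> G) (I : G -> {set G}),
    [/\ R \subset W, #|R| + j = #|W|,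
        forall w, w \in W -> grp w \in R,
        forall a, a \in R -> I a \subset L /\ #|L| <= C j * #|I a| &
        forall w z, w \in W -> z \in I (grp w) -> movable x0 f L f0 j w z].
Proof.
move=> LY dense; elim: j => [|j IH] hC hj.
  exists W, id, (fun u => [set z in L | adj u z]); split=> //; first by rewrite addn0.
  - move=> a aW; split; first by apply/subsetP => z; rewrite inE => /andP[].
    apply: leq_trans (dense a _); last by rewrite inE aW.
    by rewrite mulSn leq_addr.
  - move=> w z _; rewrite inE => /andP[zL wz]; exact: (movable_adj leaf fy0).
have [||R [grp [I [RW cR gR hI mv]]]] := IH.
- apply: leq_ltn_trans hC; rewrite leq_mul2r merge_const_leq ?orbT //.
- by rewrite addnS in hj; apply: ltnW.
have [R' R'R cR'] : exists2 R' : {set G}, R' \subset R & #|R'| = m.+1.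
  by apply: subset_of_card; lia.
have L0 : 0 < #|L| by apply: leq_ltn_trans hC.
have [||a [b [aR bR ab [K [KL cK hK]]]]] :=
    @merge_sets G (fun y z => adj (f y x0) z) m.+1 P (C j) L R' I cR' P0 L0.
- by move=> g /(subsetP R'R); apply: hI.
- by move=> y yL; apply: dense; rewrite in_setU (imset_f (fun y => f y x0) yL) orbT.
have {}aR := subsetP R'R _ aR; have {}bR := subsetP R'R _ bR.
have many c z : #|L| <= C j.+1 * #|[set y in I c | adj (f y x0) z]| ->
    f0 < #|[set y in I c | adj (f y x0) z]|.
  by move/(leq_trans hC); rewrite ltn_mul2l => /andP[].
exists (R :\ b), (fun w => if grp w == b then a else grp w), (fun c => if c == a then K else I c).
split.
- by apply: subset_trans RW; rewrite subD1set.
- by move: cR; rewrite (cardsD1 b) bR add1n addSnnS.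
- move=> w wW; case: eqVneq => [_|gb]; first by rewrite !inE ab aR.
  by rewrite !inE gb gR.
- move=> c /setD1P[_ cR0]; case: eqVneq => [_|_]; first by split.
  have [IL cI] := hI c cR0; split=> //; apply: leq_trans cI _.
  by rewrite leq_mul2r merge_const_leq ?orbT.
- move=> w z wW; have step c : grp w = c -> c \in R -> f0 < #|[set y in I c | adj (f y x0) z]| ->
      movable x0 f L f0 j.+1 w z.
    move=> gc cR0; apply: (movable_step leaf fy0 LY); first by case: (hI c cR0).
    by move=> y yI; apply: mv; rewrite ?gc.
  case: (eqVneq (grp w) b) => [gb|gb].
    by rewrite eqxx => /hK[_ /many]; apply: step.
  case: (eqVneq (grp w) a) => [ga|ga].
    by move=> /hK[/many h _]; apply: step h.
  by move=> zI; exact: (movable_leq (leqnSn j) (mv _ _ wW zI)).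
Qed.

(** As [M] exceeds m(k - 1), one of [m] groups of [M] tokens has [k] of them. Its target set is so
    large that the leaves [f z x0] over it span a copy of [T], to which these tokens are sent. The
    number [f0] is the budget of [movable_seq] for [k] moves with [l = M]. *)
Lemma augment (U L : {set G}) : L \subset Y -> state f U L ->
  let k := #|T| in let M := (m * k.-1).+1 in let f0 := k * M.+2 + M in
  (forall u, u \in U :|: [set f y x0 | y in L] ->
     P.+1 * #|L| <= m.+1 * P * #|[set z in L | adj u z]|) ->
  m * k.-1 < #|U| -> C M * f0 < #|L| -> C M * (k.-1 * al) < #|L| ->
  exists U' L' : {set G}, [/\ L' \subset L, state f U' L', #|U'| < #|U|,
    {subset U' <= U :|: [set f y x0 | y in L]} & #|L :\: L'| <= k * M.+1].
Proof.
move=> LY st k M f0 dense MU hf0 hal.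
have k1 : 0 < k.-1 by move: T1; rewrite -/k; case: (k) => [|[]].
have mM : m <= M by rewrite /M; nia.
have [W WU cW] := subset_of_card MU.
have [|||R [grp [I [RW cR gR hI mv]]]] := @group_tokens L W f0 (M - m) LY.
- move=> u; rewrite in_setU => /orP[uW|uL]; apply: dense; rewrite in_setU ?uL ?orbT //.
  by rewrite (subsetP WU).
- by apply: leq_ltn_trans hf0; rewrite leq_mul2r merge_const_leq ?leq_subr ?orbT.
- by rewrite subnKC // cW.
have {}cR : #|R| = m by rewrite cW in cR; lia.
have [|a aR ka] := fiber_pigeonhole gR (k := k.-1); first by rewrite cR cW.
have [IL cI] := hI a aR.
have finj : {in L &, injective (fun z => f z x0)}.
  exact: (state_inj fy0 LY st).
pose S := [set f z x0 | z in I a].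
have cS : #|S| = #|I a|.
  by apply: card_in_imset => z z' zI zI'; apply: finj; apply: (subsetP IL).
have [|g gc gS] := @tree_copy G T tT S.
  rewrite cS -(ltn_pmul2l (_ : 0 < C (M - m))) ?merge_const_gt0 //.
  apply: leq_trans cI; apply: leq_ltn_trans hal.
  by rewrite leq_mul2r merge_const_leq ?leq_subr ?orbT.
pose Z := [set z in I a | f z x0 \in copy_vertices g].
have ZL : {subset Z <= L} by move=> z; rewrite inE => /andP[/(subsetP IL)].
have imZ : [set f z x0 | z in Z] = copy_vertices g.
  apply/setP => v; apply/imsetP/idP => [[z]|vg]; first by rewrite inE => /andP[_ ?] ->.
  have /imsetP [z zI E] := subsetP gS _ vg.
  by exists z; rewrite // inE zI -E.
have cZ : #|Z| = k.
  rewrite /k -(card_copy_vertices gc) -imZ card_in_imset // => z z' /ZL zL /ZL zL'.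
  exact: finj.
have [B BW cB] := subset_of_card ka; rewrite prednK ?(ltnW T1) // in cB.
(* Any pairing works, because each token of the group can reach every place of [I a]. *)
pose ps := zip (enum B) (enum Z).
have sz : size (enum B) = size (enum Z) by rewrite -!cardE cZ cB.
have u1 : unzip1 ps = enum B by rewrite unzip1_zip // sz.
have u2 : unzip2 ps = enum Z by rewrite unzip2_zip // sz.
have sps : size ps = k by rewrite size_zip sz minnn -cardE cZ.
have BWa w : w \in B -> w \in W /\ grp w = a.
  by move/(subsetP BW); rewrite inE => /andP[? /eqP].
have [||||||U1 [L1 [L1L st1 cU1 sU1 [tU1 _ cL1]]]] :=
    @movable_seq G T x0 f L f0 M ps U L (subxx _) st.
- by rewrite u1 enum_uniq.
- by rewrite u2 enum_uniq.
- by move=> w; rewrite u1 mem_enum => /BWa[wW _]; apply: (subsetP WU).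
- by move=> z; rewrite u2 mem_enum => /ZL.
- move=> p pp; have : p.1 \in unzip1 ps by apply: map_f.
  have : p.2 \in unzip2 ps by apply: map_f.
  rewrite u1 u2 !mem_enum inE => /andP[pI _] /BWa[pW pa].
  by apply: (movable_leq (leq_subr m M) (mv _ _ pW _)); rewrite pa.
- by rewrite setDv cards0 sps.
have gU1 : copy_vertices g \subset U1.
  rewrite -imZ; apply/subsetP => _ /imsetP[z zZ ->].
  have : z \in unzip2 ps by rewrite u2 mem_enum.
  by case/mapP => p pp ->; apply: tU1.
exists (U1 :\: copy_vertices g), L1; split=> //.
- exact: state_add.
- by rewrite cardsDS // card_copy_vertices //; move: T1 cU1 MU; lia.
- by move=> u /setDP[/sU1].
- by rewrite -sps.
Qed.
End Augment.

Section Iterate.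
Variables (G T : sgraph) (x0 y0 : T) (f : G -> {ffun T -> G}) (Y : {set G}) (m P : nat).
Hypothesis leaf : forall z, adj x0 z -> z = y0.
Hypothesis fy0 : forall y, y \in Y -> f y y0 = y.
Hypotheses (P0 : 0 < P) (tT : is_tree T) (T1 : 1 < #|T|).
Notation al := (independence_number G).
Let k := #|T|.
Let M := (m * k.-1).+1.
Let C := merge_const m.+1 P M.

(** An augmentation spoils at most k(M + 1) tiles and shrinks [U], so the last hypothesis is an
    invariant and [nu] bounds all spoiled tiles. Neighbours lost with them cost at most one |Y|,
    which lowers [P.+2] to [P.+1]. *)
Lemma augment_iterate (nu : nat) (U L : {set G}) : L \subset Y -> state f U L ->
  (forall u, u \in U :|: [set f y x0 | y in Y] ->
     P.+2 * #|Y| <= m.+1 * P * #|[set z in Y | adj u z]|) ->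
  m.+1 * P * nu <= #|Y| -> nu + C * (k * M.+2 + M) < #|Y| ->
  nu + C * (k.-1 * al) < #|Y| -> #|Y :\: L| + k * M.+1 * #|U| <= nu ->
  exists t : {set {ffun T -> G}}, is_tiling t /\ #|~: covered t| <= m * k.-1.
Proof.
move=> LY st good h1 h2 h3; move: {2}#|U|.+1 (ltnSn #|U|) => N.
elim: N U L LY st good => // N IH U L LY st good UN hnu.
case: (leqP #|U| (m * k.-1)) => [Um|mU].
  by case: st => t [tt ct _]; exists t; rewrite ct setCK.
have cL : #|Y| <= #|Y :\: L| + #|L| by rewrite cardsD (setIidPr LY) subnK ?subset_leq_card.
have cLY : #|Y :\: L| <= nu by apply: leq_trans hnu; apply: leq_addr.
have LnY : #|Y| <= nu + #|L| by apply: leq_trans cL _; rewrite leq_add2r.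
have [|||U' [L' [L'L st' cU' sU' cL']]] := augment leaf fy0 P0 tT T1 (m := m) LY st _ mU.
- move=> u; rewrite in_setU => uUL.
  have {}uUL : u \in U :|: [set f y x0 | y in Y].
    rewrite in_setU; case/orP: uUL => [->//|/imsetP[y yL ->]].
    by rewrite (imset_f (fun y => f y x0)) ?orbT // (subsetP LY).
  have g := good u uUL.
  have cN : #|[set z in Y | adj u z]| <= #|Y :\: L| + #|[set z in L | adj u z]|.
    apply: leq_trans (leq_card_setU _ _); apply: subset_leq_card; apply/subsetP => z.
    by rewrite !inE => /andP[-> ->]; rewrite !andbT orNb.
  have {cN} := leq_mul (leqnn (m.+1 * P)) (leq_trans cN (leq_add cLY (leqnn _))).
  rewrite mulnDr => /(leq_trans g) {}g.
  have : P.+1 * #|L| <= P.+1 * #|Y| by rewrite leq_mul2l subset_leq_card ?orbT.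
  by move: g h1; rewrite !mulSn; clear; lia.
- by rewrite -(ltn_add2l nu); apply: leq_trans h2 LnY.
- by rewrite -(ltn_add2l nu); apply: leq_trans h3 LnY.
have sL : L' \subset Y := subset_trans L'L LY.
apply: (IH U' L' sL st').
- move=> u; rewrite in_setU => /orP[/sU'|uY]; last by apply: good; rewrite in_setU uY orbT.
  rewrite in_setU => uUL; apply: good; rewrite in_setU; case/orP: uUL => [->//|/imsetP[y yL ->]].
  by rewrite (imset_f (fun y => f y x0)) ?orbT // (subsetP LY).
- by apply: leq_trans cU' _.
apply: leq_trans hnu.
have cD : #|Y :\: L'| <= #|Y :\: L| + #|L :\: L'|.
  apply: leq_trans (leq_card_setU _ _); apply: subset_leq_card; apply/subsetP => w.
  by rewrite !inE; case: (w \in L); rewrite //= ?andbT ?andbF ?orbF // => /andP[].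
apply: leq_trans (leq_add cD (leqnn _)) _; rewrite -addnA leq_add2l.
apply: leq_trans (leq_add cL' (leqnn _)) _.
by rewrite -/k -/M -mulnS leq_mul2l cU' orbT.
Qed.

End Iterate.

(** * Choosing the prepared tiles *)

Lemma leq_sum_exists (V : finType) (A : {set V}) (F : V -> nat) (c : nat) :
  0 < #|A| -> \sum_(v in A) F v <= #|A| * c -> exists2 v, v \in A & F v <= c.
Proof.
move=> A0 hs; case: (pickP [pred v in A | F v <= c]) => [v /andP[]|no]; first by exists v.
have : \sum_(v in A) c.+1 <= \sum_(v in A) F v.
  apply: leq_sum => v vA; have := no v; rewrite /= vA /= => /negbT.
  by rewrite -ltnNge.
by rewrite sum_nat_const mulnS; move: A0 hs; clear; lia.
Qed.

(** For [e] equal to 0 or 1 this is x^2 <= (h - be)^2 with the subtracted terms moved across; a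
    truncated difference is 0, which only helps. *)
Lemma square_shift (b x h : nat) (e : bool) :
  x <= h - b * e -> x ^ 2 + 2 * b * h * e <= h ^ 2 + b ^ 2 * e.
Proof.
case: e; rewrite ?muln0 ?muln1 ?subn0 ?addn0 => xh; last by rewrite leq_exp2r.
apply: leq_trans (leq_add (_ : _ <= (h - b) ^ 2) (leqnn _)) _; first by rewrite leq_exp2r.
case: (leqP b h) => [bh|hb]; first by rewrite -mulnA (mulnC b) sqrnB // subnK // nat_Cauchy.
by rewrite (eqP (ltnW hb : h - b == 0)) exp0n // add0n -mulnA (mulnC b) nat_Cauchy.
Qed.

Section Sample.
Variables (G : sgraph) (a b s : nat).
Hypothesis deg : forall u : G, a * #|G| + b * s <= b * degree u.

(** Subtraction is truncated, so a surplus of neighbours over the proportion a/b counts as 0. *)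
Let deficit (Y : {set G}) (u : G) := a * #|Y| - b * #|[set y in Y | adj u y]|.

(* Adding a uniformly chosen vertex shifts each positive deficit downwards on
   average, so the sum of squares grows at most linearly. *)
Let sum_deficit (Y : {set G}) (u : G) : #|Y| <= s ->
  \sum_(y in ~: Y) deficit (y |: Y) u ^ 2 <= #|~: Y| * (deficit Y u ^ 2 + b ^ 2).
Proof.
move=> Ys; set g := deficit Y u; pose h := g + a.
have step y : y \in ~: Y ->
    deficit (y |: Y) u ^ 2 + 2 * b * h * adj u y <= h ^ 2 + b ^ 2 * adj u y.
  rewrite inE => yY.
  have -> : deficit (y |: Y) u = a * #|Y|.+1 - b * (#|[set y in Y | adj u y]| + adj u y).
    rewrite /deficit cardsU1 yY add1n; congr (_ - b * _).
    rewrite !card_sum_mem big_setU1 //=; exact: addnC.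
  apply: square_shift; rewrite /h /g /deficit mulnS mulnDr.
  by move: (a * _) (b * _) (b * _); clear; lia.
have : \sum_(y in ~: Y) (deficit (y |: Y) u ^ 2 + 2 * b * h * adj u y) <=
       \sum_(y in ~: Y) (h ^ 2 + b ^ 2 * adj u y) by apply: leq_sum.
rewrite !big_split /= -!big_distrr /= -card_sum_mem sum_nat_const.
set d := #|_|; set S := \sum_(i in _) _ => hS.
(* The term [b * s] in the degree hypothesis pays for neighbours inside [Y], so the proportion a/b
   persists outside [Y]. *)
have hd : a * #|~: Y| <= b * d.
  have cd : degree u <= #|Y| + d.
    apply: leq_trans (leq_card_setU _ _); apply: subset_leq_card; apply/subsetP => z.
    by rewrite !inE => ->; rewrite andbT orbN.
  have := leq_trans (deg u) (leq_mul (leqnn b) cd); rewrite mulnDr => h1.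
  have h2 : b * #|Y| <= b * s by rewrite leq_mul2l Ys orbT.
  have h3 : a * #|~: Y| <= a * #|G| by rewrite leq_mul2l max_card orbT.
  by move: h1 h2 h3; clear; lia.
have dN : d <= #|~: Y|.
  by apply: subset_leq_card; apply/subsetP => z; rewrite inE => /andP[].
move: hS hd dN; rewrite /h; move: (#|~: Y|) => N; clear; nia.
Qed.

(** A second-moment argument by successive choice: each new vertex of [Y] is at most average for the
    sum of squared deficits. An exceptional vertex has deficit above [s], so it contributes at least
    s^2 to a final sum of at most s |G| b^2. *)
Lemma sample_set : s <= #|G| -> exists2 Y : {set G}, #|Y| = s &
  #|[set u | b * #|[set y in Y | adj u y]| + s < a * s]| * s <= #|G| * b ^ 2.
Proof.
move=> sG.
have [Y cY hY] : exists2 Y : {set G}, #|Y| = s & \sum_u deficit Y u ^ 2 <= s * (#|G| * b ^ 2).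
  have : s <= s by []; move: {1 3 4}s => j; elim: j => [|j IH] js.
    exists set0; rewrite ?cards0 // big1 // => u _.
    by rewrite /deficit cards0 muln0 sub0n.
  have [Y cY hY] := IH (ltnW js).
  have [||y yY hy] := @leq_sum_exists _ (~: Y) (fun y => \sum_u deficit (y |: Y) u ^ 2)
      (j.+1 * (#|G| * b ^ 2)).
  - by rewrite cardsCs setCK subn_gt0 cY; apply: leq_trans sG.
  - rewrite exchange_big /=.
    apply: (@leq_trans (\sum_(u : G) #|~: Y| * (deficit Y u ^ 2 + b ^ 2))).
      by apply: leq_sum => u _; apply: sum_deficit; rewrite cY ltnW.
    rewrite -big_distrr leq_mul2l /= big_split /= sum_nat_const mulSn addnC.
    by rewrite leq_add2l hY orbT.
  by exists (y |: Y); rewrite // cardsU1; rewrite inE in yY; rewrite yY cY.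
exists Y => //; set B := [set u | _].
case: (posnP s) => [->|s0]; first by rewrite muln0.
rewrite -(leq_pmul2l s0) mulnCA mulnn; apply: leq_trans hY.
rewrite -sum_nat_const [leqRHS](bigID [in B]) /=; apply: leq_trans (leq_addr _ _).
apply: leq_sum => u; rewrite inE => hu; rewrite leq_exp2r // /deficit cY.
by move: hu; clear; lia.
Qed.

End Sample.

Section Roots.
Variables (G T : sgraph) (y0 : T).
Hypothesis tT : is_tree T.
Notation al := (independence_number G).
Let k := #|T|.

(** The tiles are chosen greedily. Each avoids [Ro] and fewer than |Ro| earlier tiles, which leaves
    more than (k - 1) alpha(G) neighbours of its root. Avoiding all of [Ro] keeps the later roots
    free. *)
Lemma root_tiles (Ro : {set G}) :
  (forall r, r \in Ro -> k.+1 * #|Ro| + k.-1 * al < degree r) ->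
  exists f : G -> {ffun T -> G}, [/\
    forall r, r \in Ro -> is_copy (f r),
    forall r, r \in Ro -> f r y0 = r,
    forall r v, r \in Ro -> v != y0 -> f r v \notin Ro &
    forall r r', r \in Ro -> r' \in Ro -> r != r' ->
      [disjoint copy_vertices (f r) & copy_vertices (f r')]].
Proof.
move=> deg.
suff [f [h1 h2 h3 h4]] : exists f : G -> {ffun T -> G}, [/\
    forall r, r \in enum Ro -> is_copy (f r),
    forall r, r \in enum Ro -> f r y0 = r,
    forall r v, r \in enum Ro -> v != y0 -> f r v \notin Ro &
    forall r r', r \in enum Ro -> r' \in enum Ro -> r != r' ->
      [disjoint copy_vertices (f r) & copy_vertices (f r')]].
  by exists f; split=> [r|r|r v|r r'] *;
    (apply: h1 || apply: h2 || apply: h3 || apply: h4); rewrite ?mem_enum.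
have : {subset enum Ro <= Ro} by move=> r; rewrite mem_enum.
have : size (enum Ro) <= #|Ro| by rewrite -cardE.
have := enum_uniq Ro.
elim: (enum Ro) => [|r s IH] /=.
  by move=> _ _ _; exists (fun r => [ffun=> r]).
move=> /andP[rs us] sR sub.
have rR : r \in Ro by apply: sub; rewrite inE eqxx.
have sub' : {subset s <= Ro} by move=> v vs; apply: sub; rewrite inE vs orbT.
have [f [h1 h2 h3 h4]] := IH us (ltnW sR) sub'.
pose W := nbh r :\: (Ro :|: \bigcup_(r' in [set v in s]) copy_vertices (f r')).
have [||g [gc gr gW]] := @rooted_tree_copy G T tT r y0 W.
- exact: subsetDl.
- have := deg r rR; rewrite /W cardsD ltn_subRL => hr; apply: leq_trans hr.
  rewrite ltnS leq_add2r mulSn; apply: leq_trans (subset_leq_card (subsetIr _ _)) _.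
  apply: leq_trans (leq_card_setU _ _) _; rewrite leq_add2l.
  apply: leq_trans (leq_card_bigcup _ _) _.
  apply: (@leq_trans (\sum_(r' in [set v in s]) k)).
    by apply: leq_sum => r'; rewrite inE => /h1 /card_copy_vertices ->.
  rewrite sum_nat_const mulnC leq_mul2l cardsE; apply/orP; right.
  exact: leq_trans (card_size _) (ltnW sR).
exists (fun v => if v == r then g else f v).
have ner v : v \in s -> (v == r) = false by move=> vs; apply: contraNF rs => /eqP <-.
have dg r' : r' \in s -> [disjoint copy_vertices g & copy_vertices (f r')].
  move=> rs'; rewrite disjoints_subset; apply/subsetP => _ /imsetP[v _ ->]; rewrite inE.
  case: (eqVneq v y0) => [->|vy].
    rewrite gr; apply/imsetP => -[w _ E].
    case: (eqVneq w y0) => wy; last by have := h3 _ _ rs' wy; rewrite -E rR.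
    by move: (ner _ rs'); rewrite -(h2 _ rs') -wy -E eqxx.
  have := gW _ vy; rewrite inE in_setU negb_or => /andP[/andP[_ nb] _].
  by apply: contra nb => vf; apply/bigcupP; exists r'; rewrite ?inE.
split.
- by move=> v; rewrite inE => /orP[/eqP->|vs]; rewrite ?eqxx ?ner //; apply: h1.
- by move=> v; rewrite inE => /orP[/eqP->|vs]; rewrite ?eqxx ?ner //; apply: h2.
- move=> v w; rewrite inE => /orP[/eqP->|vs] wy; rewrite ?eqxx ?ner //; last exact: h3.
  by have := gW _ wy; rewrite inE in_setU negb_or => /andP[/andP[]].
- move=> v w; rewrite !inE => /orP[/eqP->|vs] /orP[/eqP->|ws]; rewrite ?eqxx ?ner //.
  + by move=> _; apply: dg.
  + by move=> _; rewrite disjoint_sym; apply: dg.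
  + exact: h4.
Qed.

Lemma state_greedy (f : G -> {ffun T -> G}) (U L : {set G}) : state f U L ->
  exists U' : {set G}, [/\ U' \subset U, state f U' L & #|U'| <= k.-1 * al].
Proof.
move: {2}#|U|.+1 (ltnSn #|U|) => N; elim: N U => // N IH U UN st.
case: (leqP #|U| (k.-1 * al)) => [?|big]; first by exists U.
have [g gc gU] := tree_copy tT big.
have [||U' [U'U st' cU']] := IH (U :\: copy_vertices g).
- have k0 : 0 < k by case: tT => [[]].
  rewrite cardsDS // card_copy_vertices // -/k.
  by move: UN k0 big; clear; lia.
- exact: state_add.
by exists U'; split=> //; apply: subset_trans U'U (subsetDl _ _).
Qed.

End Roots.

(** * Putting things together *)

(** The boundedly many exceptional vertices [B] of the sample [Y] become roots too: they are covered
    from the start and are no leaves of prepared tiles, so no token ever sits on them. The slack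
    [P.+4] loses one unit to sampling, one to the permitted deficit and one to spoiled tiles. *)
Lemma tiling_exists (G T : sgraph) (m P K : nat) :
  is_tree T -> 1 < #|T| -> 0 < P ->
  let k := #|T| in let r := m.+1 in let b := r * P in
  let al := independence_number G in let n := #|G| in let s := n %/ K in
  let M := (m * k.-1).+1 in let C := merge_const r P M in
  let nu := k * M.+1 * (k.-1 * al) in
  b <= K -> K <= n -> (forall v : G, P.+4 * n <= b * degree v) ->
  r * (k.+1 * (s + 2 * K * b ^ 2) + k.-1 * al) < n ->
  b * nu <= s -> nu + C * (k * M.+2 + M) < s -> nu + C * (k.-1 * al) < s ->
  exists t : {set {ffun T -> G}}, is_tiling t /\ #|~: covered t| <= m * k.-1.
Proof.
move=> tT T1 P0 k r b al n s M C nu bK Kn deg hroot h1 h2 h3.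
have K0 : 0 < K by apply: leq_trans bK; rewrite muln_gt0 P0.
have s0 : 0 < s by rewrite divn_gt0.
have [x0 [y0 [xy leaf]]] := tree_leaf tT T1.
have Ksn : K * s <= n by rewrite mulnC leq_divM.
have bsn : b * s <= n by apply: leq_trans Ksn; rewrite leq_mul2r bK orbT.
have [||Y cY cB] := @sample_set G P.+3 b s.
- move=> u; apply: leq_trans (deg u); rewrite -/n [P.+4 * n]mulSn addnC leq_add2r //.
- exact: leq_div.
set B := [set u | _] in cB.
have cB' : #|B| <= 2 * K * b ^ 2.
  have n2 : n <= 2 * K * s.
    have : n < s.+1 * K by rewrite ltn_ceil.
    by move: Ksn s0; clear; nia.
  rewrite -(leq_pmul2r s0); apply: leq_trans cB _; rewrite -/n mulnAC.
  by rewrite leq_mul2r n2 orbT.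
pose Ro := Y :|: B.
have cRo : #|Ro| <= s + 2 * K * b ^ 2.
  by apply: leq_trans (leq_card_setU _ _) _; rewrite cY leq_add2l.
have [|f [fc fy0 fR fd]] := @root_tiles G T y0 tT Ro.
  move=> v _; apply: (@leq_ltn_trans (k.+1 * (s + 2 * K * b ^ 2) + k.-1 * al)).
    by rewrite leq_add2r leq_mul2l cRo orbT.
  have rn : n <= r * degree v.
    rewrite -(leq_pmul2l P0) mulnCA mulnA -/b; apply: leq_trans (deg v).
    by rewrite leq_mul2r -addn4 leq_addr orbT.
  by rewrite -(ltn_pmul2l (ltn0Sn m)); apply: leq_trans rn.
have YR : {subset Y <= Ro} by move=> v vY; rewrite in_setU vY.
have st0 : state f (~: covered [set f v | v in Ro]) Y.
  exists [set f v | v in Ro]; rewrite setCK; split=> //.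
    split=> [_ /imsetP[v vR ->]|_ _ /imsetP[v vR ->] /imsetP[w wR ->] ne].
      exact: fc.
    by apply: fd => //; apply: contraNneq ne => ->.
  by move=> y yY; apply: imset_f; apply: YR.
have [U [UU st cU]] := state_greedy tT st0.
have good u : u \notin B -> P.+2 * s <= b * #|[set y in Y | adj u y]|.
  by rewrite inE -leqNgt [P.+3 * s]mulSn addnC leq_add2r.
apply: (@augment_iterate G T x0 y0 f Y m P leaf _ P0 tT T1 nu U Y (subxx _) st).
- by move=> y /YR; apply: fy0.
- move=> u uU; rewrite cY; apply: good; move: uU; rewrite in_setU => /orP[/(subsetP UU)|].
    rewrite inE; apply: contra => uB; have uR : u \in Ro by rewrite in_setU uB orbT.
    have := covered_mem (imset_f f uR); move/subsetP; apply.
    by rewrite -{1}(fy0 u uR) mem_copy.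
  case/imsetP => y /YR yR ->; have : f y x0 \notin Ro.
    by apply: fR => //; apply: contraTneq xy => ->; rewrite adj_irr.
  by rewrite in_setU negb_or => /andP[].
- by rewrite cY.
- by rewrite cY.
- by rewrite cY.
- by rewrite setDv cards0 add0n leq_mul2l cU orbT.
Qed.

(** [Q] absorbs the terms linear in the independence number and [n0] the bounded ones; every summand
    gets at most a quarter of its bound. Lower bounds on |G| pass to [s] through n <= 2Ks. *)
Lemma tiling_threshold (m k P : nat) : 0 < P -> 1 < k ->
  exists Q n0, 0 < Q /\ forall G T : sgraph, is_tree T -> #|T| = k -> n0 <= #|G| ->
    (forall v : G, P.+4 * #|G| <= m.+1 * P * degree v) ->
    Q * independence_number G <= #|G| ->
    exists t : {set {ffun T -> G}}, is_tiling t /\ #|~: covered t| <= m * k.-1.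
Proof.
move=> P0 k1; pose r := m.+1; pose b := r * P; pose M := (m * k.-1).+1.
pose C := merge_const r P M; pose K := 4 * (r * k.+1) * b; pose E := k * M.+1 * k.-1.
pose f0 := k * M.+2 + M.
have b0 : 0 < b by rewrite muln_gt0 P0.
have C0 : 0 < C by apply: merge_const_gt0.
have k0 : 0 < k.-1 by move: k1; clear; lia.
have E0 : 0 < E by rewrite !muln_gt0 k0 ltnW.
have K0 : 0 < K by rewrite !muln_gt0 P0.
have K20 : 0 < 2 * K by rewrite muln_gt0 K0.
have bE0 : 0 < 4 * b * E by rewrite 2!muln_gt0 b0 E0.
have rk0 : 0 < r * k.+1 by [].
have rkK : 4 * (r * k.+1) <= K by rewrite leq_pmulr.
have bK : b <= K by rewrite leq_pmull.
exists (2 * K * (4 * b * E + 4 * C * k.-1) + 4 * (r * k.-1)).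
exists (K + 4 * (r * k.+1) * (2 * K * b ^ 2) + 2 * K * (4 * C * f0 + 1)).
split; first by rewrite ltn_addr // muln_gt0 K20 addn_gt0 bE0.
move=> G T tT cT hn deg hal; rewrite -cT.
set n := #|G| in hn deg hal *; set al := independence_number G in hal *.
pose s := n %/ K.
have Kn : K <= n by apply: leq_trans hn; rewrite -addnA leq_addr.
have sn : s * K <= n by apply: leq_divM.
have s0 : 0 < s by rewrite divn_gt0.
have n2 : n <= 2 * K * s.
  have : n < s.+1 * K by rewrite ltn_ceil.
  by move: sn s0; clear; nia.
have hal1 : (4 * b * E + 4 * C * k.-1) * al <= s.
  have : 2 * K * ((4 * b * E + 4 * C * k.-1) * al) <= 2 * K * s.
    by apply: leq_trans n2; apply: leq_trans hal; rewrite mulnA leq_mul2r leq_addr orbT.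
  by rewrite leq_pmul2l.
have hf0 : 4 * C * f0 + 1 <= s.
  have : 2 * K * (4 * C * f0 + 1) <= 2 * K * s.
    by apply: leq_trans n2; apply: leq_trans hn; rewrite leq_addl.
  by rewrite leq_pmul2l.
have hE : 4 * (b * (E * al)) <= s.
  by apply: leq_trans hal1; rewrite mulnDl -!mulnA leq_addr.
have hE1 : 4 * (E * al) <= s.
  by apply: leq_trans hE; rewrite leq_mul2l leq_pmull.
have hC : 4 * (C * (k.-1 * al)) <= s.
  by apply: leq_trans hal1; rewrite mulnDl -!mulnA leq_addl.
apply: (@tiling_exists G T m P K tT) => //; rewrite ?cT -/n -/al -/s -/M -/r -/b -/C //.
- have t1 : 4 * (r * k.+1) * s <= n.
    by apply: leq_trans sn; rewrite mulnC leq_mul2l rkK orbT.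
  have t2 : 4 * (r * k.+1) * (2 * K * b ^ 2) < n.
    apply: leq_trans hn; rewrite addnAC -[X in X < _]add0n ltn_add2r.
    by rewrite addn_gt0 K0.
  have t3 : 4 * (r * k.-1) * al <= n.
    by apply: leq_trans hal; rewrite mulnDl leq_addl.
  have dist a1 a2 a3 x y z : 4 * (a1 * (a2 * (x + y) + a3 * z)) =
      4 * (a1 * a2) * x + 4 * (a1 * a2) * y + 4 * (a1 * a3) * z by clear; ring.
  have sum3 x y z p : x <= p -> y < p -> z <= p -> x + y + z < 4 * p by clear; lia.
  by rewrite -(ltn_pmul2l (isT : 0 < 4)) dist; apply: sum3.
- have quarter x p : 4 * x <= p -> x <= p by clear; lia.
  by rewrite [k * _ * _]mulnA; apply: quarter.
- have quarters x y p : 4 * x <= p -> 4 * y + 1 <= p -> x + y < p by clear; lia.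
  by rewrite [k * _ * _]mulnA; apply: quarters; rewrite // mulnA.
- have quarters x y p : 0 < p -> 4 * x <= p -> 4 * y <= p -> x + y < p by clear; lia.
  by rewrite [k * _ * _]mulnA; apply: quarters.
Qed.

Lemma leq_min_degree (G : sgraph) (v : G) : min_degree G <= degree v.
Proof.
rewrite /min_degree; have := mem_index_enum v.
elim: (index_enum _) => // u s IH; rewrite inE big_cons geq_min.
by case/orP => [/eqP->|/IH ->]; rewrite ?leqnn ?orbT.
Qed.

Local Open Scope ring_scope.

Theorem theorem1p8 (R : realType) (k : nat) (hk : (3 <= k)%N)
    (eta : R) (eta_gt0 : 0 < eta) (eta_le1 : eta <= 1) :
  exists alpha : R, 0 < alpha /\
  exists n0 : nat, forall n : nat, (n0 <= n)%N ->
  forall G : sgraph, #|G| = n ->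
    eta * n%:R <= (min_degree G)%:R ->
    (independence_number G)%:R <= alpha * n%:R ->
  forall T : sgraph, is_tree T -> #|T| = k ->
  exists t : {set {ffun T -> G}}, is_tiling t /\ quasiperfect eta t.
Proof.
have inv_ge0 : 0 <= 1 / eta by rewrite divr_ge0 // ltW.
have [m Em] : exists m : nat, Num.floor (1 / eta) = m%:Z.
  have : 0 <= Num.floor (1 / eta) by rewrite Num.Theory.floor_ge0.
  by case: (Num.floor _) => // m _; exists m.
have lt1 : 1 < m.+1%:R * eta.
  have := Num.Theory.floorD1_gt (1 / eta); rewrite Em.
  rewrite ltr_pdivrMr // (_ : (m%:Z + 1)%:~R = m.+1%:R :> R) //.
  by rewrite -addn1 natrD intrD.
have gap0 : 0 < m.+1%:R * eta - 1 by rewrite subr_gt0.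
(* This choice gives P((m + 1) eta - 1) > 4, the room needed for [P.+4] in the degree condition. *)
pose P := (Num.truncn (4 / (m.+1%:R * eta - 1))).+1.
have hP : (P + 4)%:R <= m.+1%:R * P%:R * eta.
  have : 4 / (m.+1%:R * eta - 1) < P%:R by apply: Num.Theory.truncnS_gt.
  rewrite ltr_pdivrMr // => h; rewrite natrD; nra.
have [Q [n0 [Q0 main]]] := @tiling_threshold m k P isT (ltnW hk).
(* [Q] and [n0] were fixed before the graph and the tree, so one alpha serves all trees with [k]
   vertices. *)
exists Q%:R^-1; split; first by rewrite invr_gt0 ltr0n.
exists n0 => n hn G cG hdeg hal T tT cT.
have [|||t [tt ct]] := main G T tT cT; rewrite ?cG //.
- move=> v; rewrite -addn4 -(ler_nat R) !natrM.
  have h1 : eta * n%:R <= (degree v)%:R.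
    by apply: le_trans hdeg _; rewrite ler_nat leq_min_degree.
  apply: le_trans (ler_wpM2r (ler0n R n) hP) _.
  by rewrite -[leLHS]mulrA ler_wpM2l // mulr_ge0.
- by rewrite -(ler_nat R) natrM -ler_pdivlMl ?ltr0n.
exists t; split=> //; rewrite /quasiperfect Em cT.
rewrite (_ : k%:Z - 1 = k.-1%:Z); last by lia.
by rewrite -PoszM lez_nat.
Qed.
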